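(* For $\alpha\in\mathbb{N}_0$, $\lambda,\eta,\delta\in\mathbb{C}$ and $n\in\mathbb{N}$, the following relation holds: $${}_{\mathfrak{B}}\mathcal{F}_n^{(\alpha)}(x_1,x_2;\lambda;\eta,\delta)=\sum_{k=0}^{n}\binom{n}{k}\,\mathcal{F}_k^{(\alpha)}(x_1;\lambda;\eta,\delta)\,\mathfrak{B}_{n-k}(x_2).$$
   Context: $\mathbb{N}$ is the set of natural numbers, $\mathbb{N}_0$ the set of non-negative integers, $\mathbb{C}$ the set of complex numbers; $x_1,x_2$ are variables. For $\alpha\in\mathbb{N}_0$ and $\lambda,\eta,\delta\in\mathbb{C}$, the Bell based Apostol type polynomials ${}_{\mathfrak{B}}\mathcal{F}_n^{(\alpha)}(x_1,x_2;\lambda;\eta,\delta)$ of order $\alpha$ are defined by the generating function $$\sum_{n\ge 0}{}_{\mathfrak{B}}\mathcal{F}_n^{(\alpha)}(x_1,x_2;\lambda;\eta,\delta)\frac{t^n}{n!}=\left(\frac{2^{\eta}t^{\delta}}{\lambda e^{t}+1}\right)^{\alpha}e^{x_1t+x_2(e^t-1)},\qquad |t|<|\log(-\lambda)|.$$ The generalized Apostol type polynomials $\mathcal{F}_n^{(\alpha)}(x_1;\lambda;\eta,\delta)$ of order $\alpha$ ($\alpha\in\mathbb{N}_0$, $\lambda,\eta,\delta\in\mathbb{C}$) are defined by $$\sum_{n\ge 0}\mathcal{F}_n^{(\alpha)}(x_1;\lambda;\eta,\delta)\frac{t^n}{n!}=\left(\frac{2^{\eta}t^{\delta}}{\lambda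 e^{t}+1}\right)^{\alpha}e^{x_1t},\qquad |t|<|\log(-\lambda)|.$$ The classical Bell polynomials $\mathfrak{B}_n(x_2)$ are defined by $\sum_{n\ge 0}\mathfrak{B}_n(x_2)\frac{t^n}{n!}=e^{x_2(e^t-1)}$. *)

(* Defs.v *)
From Stdlib Require Import Reals Factorial ClassicalEpsilon.
From Coquelicot Require Import Coquelicot.

Local Open Scope C_scope.

Definition Cexp (z : C) : C :=
  (exp (Re z) * cos (Im z), exp (Re z) * sin (Im z))%R.

(* Principal argument, in (-PI, PI] for z <> 0. *)
Definition Carg (z : C) : R :=
  if Rle_dec 0 (Im z) then acos (Re z / Cmod z) else (- acos (Re z / Cmod z))%R.

(* Principal logarithm; only meaningful for z <> 0. *)
Definition Clog (z : C) : C := (ln (Cmod z), Carg z).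

(* Principal value of z ^ w; only meaningful for z <> 0. *)
Definition Ccpow (z w : C) : C := Cexp (w * Clog z).

(* [a] has exponential generating function [G] on the domain [D]. *)
Definition is_egf (D : C -> Prop) (G : C -> C) (a : nat -> C) : Prop :=
  forall t : C, D t -> is_series (fun n => a n * (t ^ n / INR (fact n))) (G t).

(* The sequence defined by the generating function [G] on [D]; it is unique as
   soon as [D] contains a punctured disc around 0.  If [G] has no expansion in
   powers of t on [D], nothing is defined and the value 0 is used. *)
Definition egf_coef (D : C -> Prop) (G : C -> C) : nat -> C :=
  match excluded_middle_informative (exists a, is_egf D G a) with
  | left H => proj1_sig (constructive_indefinite_description _ H)
  | right _ => fun _ => 0
  end.

Lemma egf_coef_spec (D : C -> Prop) (G : C -> C) :
  (exists a, is_egf D G a) -> is_egf D G (egf_coef D G).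
Proof.
intros H; unfold egf_coef.
destruct (excluded_middle_informative _) as [H'|H'].
- exact (proj2_sig (constructive_indefinite_description _ H')).
- now elim H'.
Qed.

(* |log(-lam)|, the modulus of the nonzero singularity of 1/(lam e^t + 1)
   closest to the origin.  There is no singularity for lam = 0; for lam = -1
   the value log 1 = 0 is not the relevant one, the nonzero logarithms of 1
   closest to the origin being +- 2 i PI. *)
Definition apostol_radius (lam : C) : Rbar :=
  if Ceq_dec lam 0 then p_infty
  else if Ceq_dec lam (-1)%R then Finite (2 * PI)
  else Finite (Cmod (Clog (- lam))).

(* The origin is removed because [t ^ delta] need not make sense there, and
   because lam e^t + 1 vanishes there for lam = -1. *)
Definition apostol_disc (lam t : C) : Prop :=
  t <> 0 /\ Rbar_lt (Cmod t) (apostol_radius lam).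

Definition apostol_factor (alpha : nat) (lam eta delta t : C) : C :=
  ((Ccpow 2 eta * Ccpow t delta) / (lam * Cexp t + 1)) ^ alpha.

Definition bell_apostol (n alpha : nat) (x1 x2 lam eta delta : C) : C :=
  egf_coef (apostol_disc lam)
    (fun t => apostol_factor alpha lam eta delta t
              * Cexp (x1 * t + x2 * (Cexp t - 1))) n.

Definition apostol (n alpha : nat) (x1 lam eta delta : C) : C :=
  egf_coef (apostol_disc lam)
    (fun t => apostol_factor alpha lam eta delta t * Cexp (x1 * t)) n.

Definition bell (n : nat) (x2 : C) : C :=
  egf_coef (fun _ => True) (fun t => Cexp (x2 * (Cexp t - 1))) n.

(* Main.v *)
Require Import Defs.
From Stdlib Require Import Reals Lra Lia Factorial ClassicalEpsilon.
From Coquelicot Require Import Coquelicot.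

(** The generating function of the Bell based Apostol type polynomials is the
    product of that of the Apostol type polynomials, F, and that of the Bell
    polynomials, B(t) = exp(x2 (exp t - 1)), because exp turns sums into
    products. Multiplying exponential generating functions convolves their
    coefficients binomially, so the formula follows from uniqueness of the
    coefficients ([is_egf_mult], [is_egf_unique]).

    Three points need care. The expansions are only known to converge on the
    punctured disc [apostol_disc]; this disc is open and of positive radius,
    since log(-lam) = 0 only for lam = -1, so convergence there is absolute and
    coefficients are unique. The function B must have an expansion converging
    everywhere ([ex_egf_bell]); this is an interchange of summations in
    the sum over m and n of x2^m/m! (m t)^n/n!, and rests on the power series
    of the complex exponential ([is_series_Cexp]). Finally F need not have
    an expansion, for instance when t^delta is not a power series; its
    coefficients are then 0 by convention. In that case F B has no expansion
    either, since 1/B, being B with x2 replaced by -x2, is entire and would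
    carry an expansion of F B to one of F; so both sides vanish. *)

Local Open Scope C_scope.

(** * Complex series *)

Lemma Re_sum_n (a : nat -> C) (n : nat) :
  Re (sum_n a n) = sum_n (fun k => Re (a k)) n.
Proof.
  induction n as [|n IH]; [now rewrite !sum_O|].
  rewrite !sum_Sn, <- IH. reflexivity.
Qed.

Lemma Im_sum_n (a : nat -> C) (n : nat) :
  Im (sum_n a n) = sum_n (fun k => Im (a k)) n.
Proof.
  induction n as [|n IH]; [now rewrite !sum_O|].
  rewrite !sum_Sn, <- IH. reflexivity.
Qed.

(** The topology of C is the product one, so series converge
    componentwise; this reduces complex series to real ones. *)
Lemma is_series_C (a : nat -> C) (l : C) :
  is_series a l <->
  is_series (fun n => Re (a n)) (Re l) /\ is_series (fun n => Im (a n)) (Im l).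
Proof.
  split.
  - intros H. pose proof (proj1 (filterlim_locally _ _) H) as H'.
    split; apply (proj2 (filterlim_locally _ _)); intros eps;
      destruct (H' eps) as [N HN]; exists N;
      intros n Hn; destruct (HN n Hn) as [H1 H2].
    + rewrite <- Re_sum_n. exact H1.
    + rewrite <- Im_sum_n. exact H2.
  - intros [H1 H2]. apply (proj2 (filterlim_locally _ _)). intros eps.
    destruct (proj1 (filterlim_locally _ _) H1 eps) as [N1 HN1].
    destruct (proj1 (filterlim_locally _ _) H2 eps) as [N2 HN2].
    exists (Nat.max N1 N2). intros n Hn. split.
    + change (ball (Re l) eps (Re (sum_n a n))). rewrite Re_sum_n.
      apply HN1; lia.
    + change (ball (Im l) eps (Im (sum_n a n))). rewrite Im_sum_n.
      apply HN2; lia.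
Qed.

Lemma im_le_Cmod (z : C) : (Rabs (Im z) <= Cmod z)%R.
Proof. eapply Rle_trans; [apply Rmax_r|apply Rmax_Cmod]. Qed.

Lemma is_series_0 : is_series (fun _ : nat => 0%R) 0%R.
Proof.
  apply is_series_Reals. intros e He. exists O. intros k _.
  rewrite sum_eq_R0 by auto. unfold R_dist. now rewrite Rminus_0_r, Rabs_R0.
Qed.

Lemma ex_series_Rabs_le (a b : nat -> R) :
  (forall n, (Rabs (a n) <= b n)%R) -> ex_series b -> ex_series (fun n => Rabs (a n)).
Proof.
  intros H Hb. apply (ex_series_le (fun n => Rabs (a n)) b); [|exact Hb].
  intros n. change (Rabs (Rabs (a n)) <= b n)%R. now rewrite Rabs_Rabsolu.
Qed.

Lemma ex_series_Re (a : nat -> C) :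
  ex_series (fun n => Cmod (a n)) -> ex_series (fun n => Rabs (Re (a n))).
Proof. apply ex_series_Rabs_le. intros n; apply re_le_Cmod. Qed.

Lemma ex_series_Im (a : nat -> C) :
  ex_series (fun n => Cmod (a n)) -> ex_series (fun n => Rabs (Im (a n))).
Proof. apply ex_series_Rabs_le. intros n; apply im_le_Cmod. Qed.

(** The Cauchy product of two absolutely convergent complex series. *)
Lemma is_series_mult_C (a b : nat -> C) (la lb : C) :
  is_series a la -> is_series b lb ->
  ex_series (fun n => Cmod (a n)) -> ex_series (fun n => Cmod (b n)) ->
  is_series (fun n => sum_n (fun k => a k * b (n - k)%nat) n) (la * lb).
Proof.
  rewrite !is_series_C. intros [Ha1 Ha2] [Hb1 Hb2] Ha Hb.
  pose proof (ex_series_Re a Ha) as Sa1. pose proof (ex_series_Im a Ha) as Sa2.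
  pose proof (ex_series_Re b Hb) as Sb1. pose proof (ex_series_Im b Hb) as Sb2.
  pose proof (is_series_mult _ _ _ _ Ha1 Hb1 Sa1 Sb1) as H11.
  pose proof (is_series_mult _ _ _ _ Ha1 Hb2 Sa1 Sb2) as H12.
  pose proof (is_series_mult _ _ _ _ Ha2 Hb1 Sa2 Sb1) as H21.
  pose proof (is_series_mult _ _ _ _ Ha2 Hb2 Sa2 Sb2) as H22.
  split.
  - rewrite re_mult.
    eapply is_series_ext; [|exact (is_series_minus _ _ _ _ H11 H22)].
    intros n. rewrite Re_sum_n.
    match goal with |- plus ?x (opp ?y) = ?z => change ((x - y)%R = z) end.
    rewrite <- minus_sum, <- sum_n_Reals. apply sum_n_ext.
    intros k. now rewrite re_mult.
  - rewrite im_mult.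
    eapply is_series_ext; [|exact (is_series_plus _ _ _ _ H12 H21)].
    intros n. rewrite Im_sum_n.
    match goal with |- plus ?x ?y = ?z => change ((x + y)%R = z) end.
    rewrite <- plus_sum, <- sum_n_Reals. apply sum_n_ext.
    intros k. now rewrite im_mult.
Qed.

(** * Interchange of summations *)

Lemma Series_tail_lim (b : nat -> R) :
  ex_series b -> is_lim_seq (fun M => Series (fun k => b (S M + k)%nat)) 0.
Proof.
  intros Hb.
  apply is_lim_seq_ext with (fun M => Series b - sum_n b M)%R.
  - intros M. rewrite (Series_incr_n b (S M)), sum_n_Reals; [|lia|exact Hb].
    simpl pred. ring.
  - replace (Finite 0) with (Finite (Series b - Series b)) by (f_equal; ring).
    apply is_lim_seq_minus'; [apply is_lim_seq_const|].
    exact (Series_correct b Hb).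
Qed.

Lemma is_lim_seq_sum_n (g : nat -> nat -> R) (l : nat -> R) (M : nat) :
  (forall m, is_lim_seq (fun N => g N m) (l m)) ->
  is_lim_seq (fun N => sum_n (g N) M) (sum_n l M).
Proof.
  intros H. induction M as [|M IH].
  - rewrite sum_O. apply is_lim_seq_ext with (fun N => g N O); [|apply H].
    intros N. now rewrite sum_O.
  - rewrite sum_Sn. apply is_lim_seq_ext with (fun N => sum_n (g N) M + g N (S M))%R.
    + intros N. now rewrite sum_Sn.
    + apply is_lim_seq_plus'; [exact IH|apply H].
Qed.

(** Dominated convergence for series (Tannery). *)
Lemma is_lim_seq_Series_dominated (g : nat -> nat -> R) (b : nat -> R) :
  (forall N m, (Rabs (g N m) <= b m)%R) -> ex_series b ->
  (forall m, is_lim_seq (fun N => g N m) 0) ->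
  is_lim_seq (fun N => Series (g N)) 0.
Proof.
  intros Hg Hb Hl. apply is_lim_seq_spec. intros eps.
  pose proof (Series_tail_lim b Hb) as Ht.
  apply is_lim_seq_spec in Ht. destruct (Ht (pos_div_2 eps)) as [M HM].
  specialize (HM M (le_n M)). rewrite Rminus_0_r in HM. simpl in HM.
  pose proof (is_lim_seq_sum_n g (fun _ => 0%R) M Hl) as Hs.
  rewrite sum_n_const, Rmult_0_r in Hs. apply is_lim_seq_spec in Hs.
  destruct (Hs (pos_div_2 eps)) as [N0 HN0]. exists N0. intros N HN.
  specialize (HN0 N HN). rewrite Rminus_0_r in *. simpl in HN0.
  assert (Sg : ex_series (fun m => Rabs (g N m)))
    by (apply ex_series_Rabs_le with b; [apply Hg|exact Hb]).
  rewrite (Series_incr_n (g N) (S M));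
    [|lia|now apply ex_series_Rabs]. rewrite <- sum_n_Reals. simpl pred.
  assert (Sb : ex_series (fun k => b (S M + k)%nat))
    by (apply (ex_series_incr_n b (S M)); exact Hb).
  assert (Htail : (Rabs (Series (fun k => g N (S M + k)%nat))
                   <= Series (fun k => b (S M + k)%nat))%R).
  { eapply Rle_trans; [apply Series_Rabs|apply Series_le]; try exact Sb.
    - apply ex_series_Rabs_le with (fun k => b (S M + k)%nat); [|exact Sb].
      intros k; apply Hg.
    - intros k; split; [apply Rabs_pos|apply Hg]. }
  eapply Rle_lt_trans; [apply Rabs_triang|].
  pose proof (Rle_abs (Series (fun k => b (S M + k)%nat))). simpl in *. lra.
Qed.

Lemma Rabs_sum_n_le_Series (a : nat -> R) (n : nat) :
  ex_series (fun k => Rabs (a k)) ->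
  (Rabs (sum_n a n) <= Series (fun k => Rabs (a k)))%R.
Proof.
  intros H. rewrite (Series_incr_n _ (S n)); [|lia|exact H]. simpl pred.
  rewrite sum_n_Reals.
  assert (0 <= Series (fun k => Rabs (a (S n + k)%nat)))%R.
  { replace 0%R with (Series (fun _ => 0%R))
      by apply is_series_unique, is_series_0.
    apply Series_le.
    - intros k; split; [lra|apply Rabs_pos].
    - exact (proj1 (ex_series_incr_n (fun k => Rabs (a k)) (S n)) H). }
  pose proof (Rsum_abs a n). lra.
Qed.

Lemma Rabs_le_Series (a : nat -> R) (n : nat) :
  ex_series (fun k => Rabs (a k)) -> (Rabs (a n) <= Series (fun k => Rabs (a k)))%R.
Proof.
  intros H. pose proof (Rabs_sum_n_le_Series (fun k => Rabs (a k)) n) as Hn.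
  assert (E : Series (fun k => Rabs (Rabs (a k))) = Series (fun k => Rabs (a k)))
    by (apply Series_ext; intros k; apply Rabs_Rabsolu).
  cbv beta in Hn. rewrite E in Hn.
  assert (H' : ex_series (fun k => Rabs (Rabs (a k))))
    by (apply ex_series_ext with (2 := H); intros k; symmetry; apply Rabs_Rabsolu).
  specialize (Hn H'). eapply Rle_trans; [|exact Hn].
  eapply Rle_trans; [|apply Rle_abs].
  destruct n as [|n]; [rewrite sum_O; lra|]. rewrite sum_Sn.
  change (@plus R_AbelianMonoid) with Rplus.
  assert (0 <= sum_n (fun k => Rabs (a k)) n)%R; [|lra].
  rewrite sum_n_Reals. apply cond_pos_sum. intros k; apply Rabs_pos.
Qed.

(** A finite sum of series is the series of the finite sums. *)
Lemma Series_sum_n (c : nat -> nat -> R) (N : nat) :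
  (forall n, ex_series (fun m => c m n)) ->
  ex_series (fun m => sum_n (c m) N) /\
  Series (fun m => sum_n (c m) N) = sum_n (fun n => Series (fun m => c m n)) N.
Proof.
  intros H. induction N as [|N [IH1 IH2]].
  - split.
    + apply ex_series_ext with (2 := H O). intros m. now rewrite sum_O.
    + rewrite sum_O. apply Series_ext. intros m. now rewrite sum_O.
  - assert (E : forall m, sum_n (c m) (S N) = (sum_n (c m) N + c m (S N))%R)
      by (intros m; rewrite sum_Sn; reflexivity).
    split.
    + apply ex_series_ext with (fun m => plus (sum_n (c m) N) (c m (S N))).
      * intros m. symmetry. apply E.
      * exact (ex_series_plus _ _ IH1 (H (S N))).
    + rewrite sum_Sn, (Series_ext _ _ E), Series_plus, IH2; auto.
Qed.

(** Fubini for absolutely summable real double series. The gap between the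
    sum of the columns up to N and the whole sum is a series over the rows,
    dominated by twice the absolute row sums, whose terms tend to 0 with N. *)
Lemma is_series_switch (c : nat -> nat -> R) :
  (forall m, ex_series (fun n => Rabs (c m n))) ->
  ex_series (fun m => Series (fun n => Rabs (c m n))) ->
  is_series (fun n => Series (fun m => c m n)) (Series (fun m => Series (c m))).
Proof.
  intros Hc Hs.
  assert (Hcol : forall n, ex_series (fun m => c m n)).
  { intros n. apply ex_series_Rabs.
    apply ex_series_Rabs_le with (2 := Hs). intros m.
    exact (Rabs_le_Series (c m) n (Hc m)). }
  assert (Hrow : ex_series (fun m => Series (c m))).
  { apply ex_series_Rabs.
    apply ex_series_Rabs_le with (2 := Hs). intros m. now apply Series_Rabs. }
  set (L := Series (fun m => Series (c m))).
  assert (H0 : is_lim_seq (fun N => Series (fun m => sum_n (c m) N - Series (c m))%R) 0).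
  { apply is_lim_seq_Series_dominated
      with (b := fun m => (2 * Series (fun n => Rabs (c m n)))%R).
    - intros N m. eapply Rle_trans; [apply Rabs_triang|]. rewrite Rabs_Ropp.
      pose proof (Rabs_sum_n_le_Series (c m) N (Hc m)).
      pose proof (Series_Rabs (c m) (Hc m)). lra.
    - exact (ex_series_scal 2%R _ Hs).
    - intros m. replace (Finite 0) with (Finite (Series (c m) - Series (c m)))
        by (f_equal; ring).
      apply is_lim_seq_minus'; [|apply is_lim_seq_const].
      exact (Series_correct _ (ex_series_Rabs _ (Hc m))). }
  apply (is_lim_seq_ext
    (fun N => Series (fun m => sum_n (c m) N - Series (c m)) + L)%R _ L).
  - intros N. destruct (Series_sum_n c N Hcol) as [H1 H2].
    rewrite Series_minus, H2; [|exact H1|exact Hrow].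
    assert (E : forall a b : R, (a - b + b)%R = a) by (intros; ring). apply E.
  - pose proof (is_lim_seq_plus' _ _ _ _ H0 (is_lim_seq_const L)) as H1.
    rewrite Rplus_0_l in H1. exact H1.
Qed.

(** Fubini for absolutely summable complex double series: [s m] and [l m] are
    the absolute sum and the sum of row [m]; the column sums [d n] are only
    asserted to exist. *)
Lemma is_series_switch_C (c : nat -> nat -> C) (s : nat -> R) (l : nat -> C) (L : C) :
  (forall m, is_series (fun n => Cmod (c m n)) (s m)) -> ex_series s ->
  (forall m, is_series (c m) (l m)) -> is_series l L ->
  exists d, (forall n, is_series (fun m => c m n) (d n)) /\ is_series d L.
Proof.
  intros Hs Ss Hl HL.
  assert (Hc : forall m, ex_series (fun n => Cmod (c m n))) by (intros m; now exists (s m)).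
  assert (Part : forall p : C -> R, (forall z, (Rabs (p z) <= Cmod z)%R) ->
    (forall m, is_series (fun n => p (c m n)) (p (l m))) ->
    is_series (fun m => p (l m)) (p L) ->
    (forall n, is_series (fun m => p (c m n)) (Series (fun m => p (c m n)))) /\
    is_series (fun n => Series (fun m => p (c m n))) (p L)).
  { intros p Hp Hpl HpL.
    assert (Hpc : forall m, ex_series (fun n => Rabs (p (c m n)))).
    { intros m. apply ex_series_Rabs_le with (2 := Hc m). intros n; apply Hp. }
    assert (Hle : forall m, (Series (fun n => Rabs (p (c m n))) <= s m)%R).
    { intros m. rewrite <- (is_series_unique _ _ (Hs m)). apply Series_le; [|apply Hc].
      intros n; split; [apply Rabs_pos|apply Hp]. }
    assert (Hps : ex_series (fun m => Series (fun n => Rabs (p (c m n))))).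
    { apply (ex_series_le (fun m => Series (fun n => Rabs (p (c m n)))) s); [|exact Ss].
      intros m. change (Rabs (Series (fun n => Rabs (p (c m n)))) <= s m)%R.
      rewrite Rabs_pos_eq; [apply Hle|].
      exact (Rle_trans _ _ _ (Rabs_pos _) (Rabs_le_Series _ O (Hpc m))). }
    split.
    - intros n. apply Series_correct, ex_series_Rabs.
      apply ex_series_Rabs_le with (2 := Hps). intros m.
      exact (Rabs_le_Series (fun n => p (c m n)) n (Hpc m)).
    - rewrite <- (is_series_unique _ _ HpL).
      rewrite (Series_ext _ (fun m => Series (fun n => p (c m n)))).
      + now apply (is_series_switch (fun m n => p (c m n))).
      + intros m. symmetry. apply is_series_unique, Hpl. }
  destruct (proj1 (is_series_C _ _) HL) as [HL1 HL2].
  destruct (Part Re re_le_Cmod) as [R1 R2];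
    [intros m; exact (proj1 (proj1 (is_series_C _ _) (Hl m)))|exact HL1|].
  destruct (Part Im im_le_Cmod) as [I1 I2];
    [intros m; exact (proj2 (proj1 (is_series_C _ _) (Hl m)))|exact HL2|].
  exists (fun n => (Series (fun m => Re (c m n)), Series (fun m => Im (c m n)))).
  split; [intros n|]; apply is_series_C; split; simpl; auto.
Qed.

(* [ring] for equations whose type is a canonical structure on C, as produced
   by the generic lemmas on sums. *)
Ltac Cring :=
  match goal with |- ?a = ?b => change (@eq C a b); ring end.

(** * The complex exponential series *)

Lemma Cexp_plus (z w : C) : Cexp (z + w) = Cexp z * Cexp w.
Proof.
  unfold Cexp. rewrite re_plus.
  replace (Im (z + w)) with (Im z + Im w)%R by reflexivity.
  rewrite exp_plus, cos_plus, sin_plus.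
  apply injective_projections; simpl; ring.
Qed.

Lemma Cexp_0 : Cexp 0 = 1.
Proof.
  unfold Cexp; simpl. rewrite exp_0, cos_0, sin_0.
  apply injective_projections; simpl; ring.
Qed.

Lemma Cexp_INR_mult (m : nat) (z : C) : Cexp (INR m * z) = Cexp z ^ m.
Proof.
  induction m as [|m IH].
  - replace (INR 0 * z) with (RtoC 0) by (simpl; ring). apply Cexp_0.
  - rewrite S_INR, RtoC_plus, Cpow_S, <- IH, <- Cexp_plus. f_equal. ring.
Qed.

Lemma C_INR_fact_neq_0 (n : nat) : RtoC (INR (fact n)) <> 0.
Proof. intros H. apply RtoC_inj in H. exact (INR_fact_neq_0 n H). Qed.

Lemma Cmod_exp_term (z : C) (n : nat) :
  Cmod (z ^ n / INR (fact n)) = (Cmod z ^ n / INR (fact n))%R.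
Proof.
  rewrite Cmod_div by apply C_INR_fact_neq_0.
  rewrite Cmod_pow, Cmod_R, Rabs_pos_eq; [reflexivity|apply pos_INR].
Qed.

Lemma is_series_exp (x : R) : is_series (fun n => x ^ n / INR (fact n))%R (exp x).
Proof.
  eapply is_series_ext; [|exact (proj1 (is_pseries_R _ _ _) (is_exp_Reals x))].
  intros n. cbv beta. unfold Rdiv. apply Rmult_comm.
Qed.

Lemma is_series_Cmod_exp_term (z : C) :
  is_series (fun n => Cmod (z ^ n / INR (fact n))) (exp (Cmod z)).
Proof.
  apply is_series_ext with (2 := is_series_exp (Cmod z)).
  intros n. symmetry. apply Cmod_exp_term.
Qed.

Lemma Ci_pow_even (n : nat) : Ci ^ (2 * n) = RtoC ((-1) ^ n).
Proof.
  rewrite Cpow_mult_r, RtoC_pow. f_equal.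
  apply injective_projections; simpl; ring.
Qed.

Lemma Ci_pow_odd (n : nat) : Ci ^ (2 * n + 1) = Ci * RtoC ((-1) ^ n).
Proof. rewrite Cpow_add_r, Ci_pow_even, Cpow_1_r. apply Cmult_comm. Qed.

(** Euler's formula: the even and odd terms are the series of cos and sin. *)
Lemma is_series_Cexp_imaginary (y : R) :
  is_series (fun n => (Ci * y) ^ n / INR (fact n)) (Cexp (Ci * y)).
Proof.
  replace (Cexp (Ci * y)) with ((cos y, sin y) : C).
  2:{ unfold Cexp. replace (Re (Ci * y)) with 0%R by (unfold Re; simpl; ring).
      replace (Im (Ci * y)) with y by (unfold Im; simpl; ring).
      rewrite exp_0. apply injective_projections; simpl; ring. }
  assert (E : forall n, (Ci * y) ^ n / INR (fact n)
                        = Ci ^ n * RtoC (/ INR (fact n) * y ^ n)).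
  { intros n. rewrite Cpow_mult_l, <- RtoC_pow, RtoC_mult, RtoC_inv
      by apply INR_fact_neq_0. unfold Cdiv. ring. }
  apply is_series_C; split.
  - change (Re (cos y, sin y)) with (cos y).
    apply is_series_ext with (fun n => (Re (Ci ^ n) * / INR (fact n)) * y ^ n)%R.
    { intros n. rewrite E, re_scal_r. apply Rmult_assoc. }
    apply is_pseries_R. replace (cos y) with (cos y + y * 0)%R by ring.
    apply is_pseries_odd_even; apply is_pseries_R.
    + apply is_series_Reals. unfold cos. destruct (exist_cos (Rsqr y)) as [c Hc].
      unfold cos_in in Hc. apply is_series_Reals. apply is_series_Reals in Hc.
      apply is_series_ext with (2 := Hc). intros n.
      rewrite Ci_pow_even, re_RtoC, <- Rsqr_pow2. unfold cos_n. reflexivity.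
    + apply is_series_ext with (2 := is_series_0). intros n.
      rewrite Ci_pow_odd, re_scal_r. change (Re Ci) with 0%R.
      now rewrite !Rmult_0_l.
  - change (Im (cos y, sin y)) with (sin y).
    apply is_series_ext with (fun n => (Im (Ci ^ n) * / INR (fact n)) * y ^ n)%R.
    { intros n. rewrite E, im_scal_r. apply Rmult_assoc. }
    unfold sin. destruct (exist_sin (Rsqr y)) as [s Hs].
    unfold sin_in in Hs. apply is_series_Reals in Hs.
    apply is_pseries_R. rewrite <- (Rplus_0_l (y * s)).
    apply is_pseries_odd_even; apply is_pseries_R.
    + apply is_series_ext with (2 := is_series_0). intros n.
      rewrite Ci_pow_even, im_RtoC. now rewrite !Rmult_0_l.
    + apply is_series_ext with (2 := Hs). intros n.
      rewrite Ci_pow_odd, <- Rsqr_pow2, im_scal_r. change (Im Ci) with 1%R.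
      rewrite Rmult_1_l. reflexivity.
Qed.

Lemma sum_n_C_head (a : nat -> C) (n : nat) :
  sum_n a (S n) = a O + sum_n (fun k => a (S k)) n.
Proof.
  induction n as [|n IH].
  - rewrite sum_Sn, !sum_O. reflexivity.
  - rewrite sum_Sn, IH, sum_Sn. change (@plus C_AbelianMonoid) with Cplus. Cring.
Qed.

Lemma Cexp_term_S (z : C) (k : nat) :
  INR (S k) * (z ^ S k / INR (fact (S k))) = z * (z ^ k / INR (fact k)).
Proof.
  rewrite fact_simpl, mult_INR, RtoC_mult, Cpow_S.
  assert (RtoC (INR (S k)) <> 0)
    by (intros H; apply RtoC_inj in H; exact (not_0_INR (S k) (Nat.neq_succ_0 k) H)).
  pose proof (C_INR_fact_neq_0 k). field. now split.
Qed.

(** The binomial theorem in exponential normalisation. *)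
Lemma Cexp_term_plus (x y : C) (n : nat) :
  sum_n (fun k => x ^ k / INR (fact k) * (y ^ (n - k) / INR (fact (n - k)))) n
  = (x + y) ^ n / INR (fact n).
Proof.
  induction n as [|n IH].
  { rewrite sum_O. simpl. field. }
  assert (HS : RtoC (INR (S n)) <> 0)
    by (intros H; apply RtoC_inj in H; exact (not_0_INR (S n) (Nat.neq_succ_0 n) H)).
  assert (Hreg : forall u v : C, INR (S n) * u = INR (S n) * v -> u = v).
  { intros u v E. replace u with (/ INR (S n) * (INR (S n) * u)) by (field; exact HS).
    rewrite E. field. exact HS. }
  apply Hreg.
  rewrite Cexp_term_S, <- IH, Cmult_plus_distr_r.
  transitivity
    (sum_n (fun k => INR k * (x ^ k / INR (fact k))
                     * (y ^ (S n - k) / INR (fact (S n - k)))) (S n)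
     + sum_n (fun k => x ^ k / INR (fact k)
                     * (INR (S n - k) * (y ^ (S n - k) / INR (fact (S n - k))))) (S n)).
  (* n + 1 = k + (n + 1 - k), and each part is absorbed in a factorial. *)
  - etransitivity; [symmetry; apply (sum_n_mult_l (K := C_Ring))|].
    etransitivity; [|apply (sum_n_plus (G := C_AbelianMonoid))].
    apply sum_n_ext_loc. intros k Hk.
    replace (INR (S n)) with (INR k + INR (S n - k))%R
      by (rewrite <- plus_INR; f_equal; lia).
    change (@plus C_AbelianMonoid) with Cplus. change (@mult C_Ring) with Cmult.
    rewrite RtoC_plus. Cring.
  - f_equal.
    + rewrite sum_n_C_head.
      etransitivity; [|apply (sum_n_mult_l (K := C_Ring))].
      simpl INR at 1. rewrite !Cmult_0_l, Cplus_0_l.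
      apply sum_n_ext. intros k. rewrite Cexp_term_S, Nat.sub_succ.
      change (@mult C_Ring) with Cmult. Cring.
    + rewrite sum_Sn, Nat.sub_diag. change (@plus C_AbelianMonoid) with Cplus.
      simpl (INR 0). rewrite Cmult_0_l, Cmult_0_r, Cplus_0_r.
      etransitivity; [|apply (sum_n_mult_l (K := C_Ring))].
      apply sum_n_ext_loc. intros k Hk. rewrite Nat.sub_succ_l by exact Hk.
      rewrite Cexp_term_S. change (@mult C_Ring) with Cmult. Cring.
Qed.

Lemma is_series_Cexp (z : C) : is_series (fun n => z ^ n / INR (fact n)) (Cexp z).
Proof.
  assert (Ez : z = Re z + Ci * Im z)
    by (apply injective_projections; unfold Re, Im; simpl; ring).
  assert (Hre : is_series (fun n => RtoC (Re z) ^ n / INR (fact n)) (Cexp (Re z))).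
  { assert (E : forall n, RtoC (Re z) ^ n / INR (fact n)
                          = RtoC (Re z ^ n / INR (fact n))).
    { intros n. now rewrite RtoC_div, RtoC_pow by apply INR_fact_neq_0. }
    replace (Cexp (Re z)) with (RtoC (exp (Re z)))
      by (unfold Cexp; simpl; rewrite cos_0, sin_0, Rmult_1_r, Rmult_0_r; reflexivity).
    apply is_series_C. split.
    - apply is_series_ext with (2 := is_series_exp (Re z)). intros n. now rewrite E.
    - apply is_series_ext with (2 := is_series_0). intros n. now rewrite E. }
  replace (Cexp z) with (Cexp (Re z) * Cexp (Ci * Im z))
    by (rewrite <- Cexp_plus, <- Ez; reflexivity).
  eapply is_series_ext;
    [|apply (is_series_mult_C _ _ _ _ Hre (is_series_Cexp_imaginary (Im z)))].
  - intros n. cbv beta. now rewrite Cexp_term_plus, <- Ez.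
  - eexists; apply is_series_Cmod_exp_term.
  - eexists; apply is_series_Cmod_exp_term.
Qed.

(** * Exponential generating functions *)

(** The binomial convolution of two sequences, which is the operation on
    coefficients matching the product of exponential generating functions. *)
Definition binomial_conv (a b : nat -> C) (n : nat) : C :=
  sum_n (fun k => RtoC (Binomial.C n k) * a k * b (n - k)%nat) n.

Lemma egf_term_conv (a b : nat -> C) (t : C) (n : nat) :
  sum_n (fun k => a k * (t ^ k / INR (fact k))
                  * (b (n - k)%nat * (t ^ (n - k) / INR (fact (n - k))))) n
  = binomial_conv a b n * (t ^ n / INR (fact n)).
Proof.
  unfold binomial_conv.
  etransitivity; [|apply (sum_n_mult_r (K := C_Ring))].
  apply sum_n_ext_loc. intros k Hk. change (@mult C_Ring) with Cmult.
  replace (t ^ n) with (t ^ k * t ^ (n - k))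
    by (rewrite <- Cpow_add_r; f_equal; lia).
  unfold Binomial.C.
  rewrite RtoC_div, RtoC_mult
    by (apply Rmult_integral_contrapositive; split; apply INR_fact_neq_0).
  pose proof (C_INR_fact_neq_0 n). pose proof (C_INR_fact_neq_0 k).
  pose proof (C_INR_fact_neq_0 (n - k)).
  match goal with |- ?a = ?b => change (@eq C a b) end.
  field. repeat split; assumption.
Qed.

(** Abel's lemma: convergence at [t'] gives absolute convergence at every
    point of smaller modulus, by comparison with a geometric series. *)
Lemma ex_series_Cmod_egf_term (a : nat -> C) (t t' : C) :
  (Cmod t < Cmod t')%R ->
  ex_series (fun n => a n * (t' ^ n / INR (fact n))) ->
  ex_series (fun n => Cmod (a n * (t ^ n / INR (fact n)))).
Proof.
  intros Htt' [l Hl].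
  pose proof (Cmod_ge_0 t) as Ht.
  destruct (filterlim_bounded _ (ex_intro _ l Hl)) as [M HM].
  set (u := fun n => a n * (t' ^ n / INR (fact n))) in *.
  assert (HM0 : forall n, (Cmod (sum_n u n) <= M)%R) by exact HM.
  assert (Hu : forall n, (Cmod (u n) <= 2 * M)%R).
  { intros n. pose proof (HM0 O) as H0. pose proof (Cmod_ge_0 (sum_n u O)).
    destruct n as [|n].
    - rewrite sum_O in *. lra.
    - replace (u (S n)) with (sum_n u (S n) + - sum_n u n)
        by (rewrite sum_Sn; change (@plus C_AbelianMonoid) with Cplus; Cring).
      eapply Rle_trans; [apply Cmod_triangle|]. rewrite Cmod_opp.
      pose proof (HM0 (S n)). pose proof (HM0 n). lra. }
  set (q := (Cmod t / Cmod t')%R).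
  assert (Hq0 : (0 <= q)%R) by (apply Rdiv_le_0_compat; lra).
  assert (Hq : (Rabs q < 1)%R).
  { rewrite Rabs_pos_eq by exact Hq0. apply Rlt_div_l; lra. }
  apply (ex_series_le (fun n => Cmod (a n * (t ^ n / INR (fact n))))
                      (fun n => 2 * M * q ^ n)%R).
  - intros n. change (norm (Cmod ?x)) with (Rabs (Cmod x)).
    rewrite Rabs_pos_eq by apply Cmod_ge_0.
    replace (Cmod (a n * (t ^ n / INR (fact n)))) with (Cmod (u n) * q ^ n)%R.
    + apply Rmult_le_compat_r; [now apply pow_le|apply Hu].
    + unfold u, q. rewrite !Cmod_mult, !Cmod_exp_term. unfold Rdiv.
      rewrite Rpow_mult_distr, pow_inv.
      field. split; [apply INR_fact_neq_0|apply pow_nonzero; lra].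
  - apply (ex_series_scal (2 * M)%R (fun n => q ^ n)%R).
    exact (ex_intro _ _ (is_series_geom q Hq)).
Qed.

(** If [D] has no point of maximal modulus, expansions on [D] converge
    absolutely there and can be multiplied. *)
Lemma is_egf_mult (D : C -> Prop) (F G : C -> C) (a b : nat -> C) :
  (forall t, D t -> exists t', D t' /\ (Cmod t < Cmod t')%R) ->
  is_egf D F a -> is_egf D G b ->
  is_egf D (fun t => F t * G t) (binomial_conv a b).
Proof.
  intros HD Ha Hb t Ht. destruct (HD t Ht) as (t' & Ht' & Hlt).
  eapply is_series_ext;
    [|apply (is_series_mult_C _ _ _ _ (Ha t Ht) (Hb t Ht))].
  - intros n. apply egf_term_conv.
  - apply ex_series_Cmod_egf_term with (1 := Hlt). exact (ex_intro _ _ (Ha t' Ht')).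
  - apply ex_series_Cmod_egf_term with (1 := Hlt). exact (ex_intro _ _ (Hb t' Ht')).
Qed.

Lemma CV_radius_ge (u : nat -> R) (x : R) :
  ex_series (fun n => u n * x ^ n)%R -> Rbar_le (Rabs x) (CV_radius u).
Proof.
  intros H. apply Rbar_not_lt_le. intros Hlt.
  exact (CV_disk_outside u x Hlt (ex_series_lim_0 _ H)).
Qed.

(** Uniqueness of power series coefficients when the sums are only known to
    agree away from 0; they then agree at 0 by continuity. *)
Lemma pseries_unique_punctured (u v : nat -> R) (f : R -> R) (r : R) :
  (0 < r)%R ->
  (forall t, (0 < Rabs t < r)%R -> is_series (fun n => u n * t ^ n)%R (f t)) ->
  (forall t, (0 < Rabs t < r)%R -> is_series (fun n => v n * t ^ n)%R (f t)) ->
  forall n, u n = v n.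
Proof.
  intros Hr Hu Hv.
  assert (Hr2 : (0 < Rabs (r / 2) < r)%R) by (rewrite Rabs_pos_eq; lra).
  assert (Ru : Rbar_lt 0 (CV_radius u)).
  { apply Rbar_lt_le_trans with (Rabs (r / 2)); [exact (proj1 Hr2)|].
    apply CV_radius_ge. exact (ex_intro _ _ (Hu _ Hr2)). }
  assert (Rv : Rbar_lt 0 (CV_radius v)).
  { apply Rbar_lt_le_trans with (Rabs (r / 2)); [exact (proj1 Hr2)|].
    apply CV_radius_ge. exact (ex_intro _ _ (Hv _ Hr2)). }
  assert (Hne : forall t, (0 < Rabs t < r)%R -> PSeries u t = PSeries v t).
  { intros t Ht. transitivity (f t); [|symmetry]; apply is_series_unique; auto. }
  assert (H0 : PSeries u 0 = PSeries v 0).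
  { assert (Hc : continuity_pt (fun t => PSeries u t - PSeries v t)%R 0).
    { apply continuity_pt_minus; apply PSeries_continuity; now rewrite Rabs_R0. }
    destruct (Req_dec (PSeries u 0) (PSeries v 0)) as [E|E]; [exact E|exfalso].
    destruct (Hc (Rabs (PSeries u 0 - PSeries v 0))) as (d & Hd & Hd').
    { apply Rabs_pos_lt. lra. }
    set (t := Rmin (d / 2) (r / 2)).
    assert (Ht : (0 < t /\ t <= d / 2 /\ t <= r / 2)%R).
    { unfold t. split; [apply Rmin_pos; lra|split; [apply Rmin_l|apply Rmin_r]]. }
    specialize (Hd' t).
    rewrite (Hne t) in Hd' by (rewrite Rabs_pos_eq; lra).
    simpl in Hd'. unfold R_dist in Hd'.
    replace (PSeries v t - PSeries v t - (PSeries u 0 - PSeries v 0))%R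
      with (- (PSeries u 0 - PSeries v 0))%R in Hd' by ring.
    rewrite Rabs_Ropp in Hd'. refine (Rlt_irrefl _ (Hd' _)).
    split; [split; [exact I|lra]|]. rewrite Rminus_0_r, Rabs_pos_eq; lra. }
  intros n. apply PSeries_ext_recip; [exact Ru|exact Rv|].
  exists (mkposreal r Hr). intros t Ht.
  assert (Ht' : (Rabs t < r)%R).
  { rewrite <- (Rminus_0_r t). exact Ht. }
  destruct (Req_dec t 0) as [->|Hn]; [exact H0|].
  apply Hne. split; [now apply Rabs_pos_lt|exact Ht'].
Qed.

(** An exponential generating function on a domain containing a punctured disc
    around 0 determines its coefficients; real arguments already suffice. *)
Lemma is_egf_unique (D : C -> Prop) (G : C -> C) (r : R) (a b : nat -> C) :
  (0 < r)%R -> (forall t : C, t <> 0 -> (Cmod t < r)%R -> D t) ->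
  is_egf D G a -> is_egf D G b -> forall n, a n = b n.
Proof.
  intros Hr HD Ha Hb n.
  assert (HDR : forall t : R, (0 < Rabs t < r)%R -> D t).
  { intros t [Ht1 Ht2]. apply HD; [|now rewrite Cmod_R].
    intros E. apply RtoC_inj in E. rewrite E, Rabs_R0 in Ht1. lra. }
  assert (E : forall (c : nat -> C) (t : R) k,
    c k * (RtoC t ^ k / INR (fact k)) = c k * RtoC (/ INR (fact k) * t ^ k)).
  { intros c t k. rewrite RtoC_mult, RtoC_pow, RtoC_inv by apply INR_fact_neq_0.
    unfold Cdiv. ring. }
  assert (Part : forall p : C -> R, (forall z x, p (z * RtoC x) = (p z * x)%R) ->
     (forall (c : nat -> C) l, is_series c l -> is_series (fun k => p (c k)) (p l)) ->
     p (a n) = p (b n)).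
  { intros p Hp Hps.
    assert (Hc : forall c, is_egf D G c -> forall t : R, (0 < Rabs t < r)%R ->
      is_series (fun k => p (c k) * / INR (fact k) * t ^ k)%R (p (G t))).
    { intros c Hc t Ht. eapply is_series_ext; [|apply Hps, (Hc t), HDR, Ht].
      intros k. cbv beta. rewrite E, Hp. symmetry. apply Rmult_assoc. }
    pose proof (pseries_unique_punctured _ _ _ r Hr (Hc a Ha) (Hc b Hb) n) as Hn.
    apply Rmult_eq_reg_r with (1 := Hn). apply Rinv_neq_0_compat, INR_fact_neq_0. }
  apply injective_projections.
  - apply (Part Re re_scal_r). intros c l Hc. apply (proj1 (is_series_C c l) Hc).
  - apply (Part Im im_scal_r). intros c l Hc. apply (proj1 (is_series_C c l) Hc).
Qed.

Lemma egf_coef_eq (D : C -> Prop) (G : C -> C) (r : R) (a : nat -> C) (n : nat) :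
  (0 < r)%R -> (forall t : C, t <> 0 -> (Cmod t < r)%R -> D t) ->
  is_egf D G a -> egf_coef D G n = a n.
Proof.
  intros Hr HD Ha. apply is_egf_unique with (1 := Hr) (2 := HD) (4 := Ha).
  apply egf_coef_spec. now exists a.
Qed.

Lemma egf_coef_none (D : C -> Prop) (G : C -> C) (n : nat) :
  ~ (exists a, is_egf D G a) -> egf_coef D G n = 0.
Proof.
  intros H. unfold egf_coef.
  destruct (excluded_middle_informative _) as [H'|_];
    [now elim H|reflexivity].
Qed.

Lemma exp_INR_mult (m : nat) (r : R) : exp (INR m * r) = (exp r ^ m)%R.
Proof.
  induction m as [|m IH]; [now rewrite Rmult_0_l, exp_0|].
  rewrite S_INR, Rmult_plus_distr_r, Rmult_1_l, exp_plus, IH. simpl. ring.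
Qed.

(** The generating function of the Bell polynomials is entire. Up to the factor
    exp(-x) it is the sum over m of x^m/m! exp(m t); expanding each exp(m t)
    gives a double series that is absolutely summable, with total
    exp(|x| exp|t|), so the summations can be interchanged. *)
Lemma ex_egf_bell (x : C) :
  exists b, is_egf (fun _ => True) (fun t => Cexp (x * (Cexp t - 1))) b.
Proof.
  assert (Hd : forall t, exists d : nat -> C,
    (forall n, is_series (fun m => x ^ m / INR (fact m)
                                   * ((INR m * t) ^ n / INR (fact n))) (d n))
    /\ is_series d (Cexp (x * Cexp t))).
  { intros t.
    apply is_series_switch_C with
      (s := fun m => ((Cmod x * exp (Cmod t)) ^ m / INR (fact m))%R)
      (l := fun m => (x * Cexp t) ^ m / INR (fact m)).
    - intros m.
      replace ((Cmod x * exp (Cmod t)) ^ m / INR (fact m))%R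
        with (Cmod (x ^ m / INR (fact m)) * exp (Cmod (INR m * t)))%R.
      + apply is_series_ext with
          (fun n => Cmod (x ^ m / INR (fact m))
                    * Cmod ((INR m * t) ^ n / INR (fact n)))%R.
        * intros n. symmetry. apply Cmod_mult.
        * exact (is_series_scal_l (V := R_NormedModule) (Cmod (x ^ m / INR (fact m)))
                   _ _ (is_series_Cmod_exp_term (INR m * t))).
      + rewrite Cmod_exp_term, Cmod_mult, Cmod_R, (Rabs_pos_eq _ (pos_INR m)).
        rewrite Rpow_mult_distr, exp_INR_mult. unfold Rdiv. ring.
    - eexists; apply is_series_exp.
    - intros m. rewrite Cpow_mult_l, <- Cexp_INR_mult.
      replace (x ^ m * Cexp (INR m * t) / INR (fact m))
        with (x ^ m / INR (fact m) * Cexp (INR m * t)) by (unfold Cdiv; ring).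
      exact (is_series_scal_l (V := C_NormedModule) (x ^ m / INR (fact m))
               _ _ (is_series_Cexp (INR m * t))).
    - apply is_series_Cexp. }
  (* The n-th column sum at t is t^n times the one at 1, so the coefficients
     (given by Dobinski's formula) are read off at t = 1. *)
  destruct (Hd 1) as (d1 & Hd1 & _).
  exists (fun n => Cexp (- x) * (INR (fact n) * d1 n)). intros t _.
  destruct (Hd t) as (d & Hdt & HL).
  replace (x * (Cexp t - 1)) with (- x + x * Cexp t) by ring. rewrite Cexp_plus.
  apply is_series_ext with (fun n => scal (Cexp (- x)) (d n)).
  - intros n. change (scal (Cexp (- x)) (d n)) with (Cexp (- x) * d n).
    replace (d n) with (t ^ n * d1 n).
    + pose proof (C_INR_fact_neq_0 n).
      match goal with |- ?a = ?b => change (@eq C a b) end. field. assumption.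
    + refine (filterlim_locally_unique _ _ _ _ (Hdt n)).
      change (is_series (fun m => x ^ m / INR (fact m)
                                   * ((INR m * t) ^ n / INR (fact n))) (t ^ n * d1 n)).
      eapply is_series_ext; [|exact (is_series_scal_l (t ^ n) _ _ (Hd1 n))].
      intros m. cbv beta. rewrite !Cpow_mult_l, Cpow_1_l.
      change (@scal C_AbsRing C_NormedModule) with Cmult. unfold Cdiv. Cring.
  - exact (is_series_scal_l _ _ _ HL).
Qed.

(** * The disc of convergence *)

(** The principal logarithm vanishes only at 1. *)
Lemma Clog_eq_0 (z : C) : z <> 0 -> Clog z = 0 -> z = 1.
Proof.
  intros Hz H. unfold Clog in H.
  injection H as Hln Harg.
  pose proof (proj1 (Cmod_gt_0 z) Hz) as Hpos.
  assert (Hm : Cmod z = 1%R).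
  { destruct (Req_dec (Cmod z) 1) as [E|E]; [exact E|].
    now elim (ln_neq_0 _ E Hpos). }
  assert (Hac : acos (Re z / Cmod z) = 0%R)
    by (unfold Carg in Harg; destruct (Rle_dec 0 (Im z)); lra).
  rewrite Hm in Hac. unfold Rdiv in Hac. rewrite Rinv_1, Rmult_1_r in Hac.
  pose proof (re_le_Cmod z) as Hre. rewrite Hm in Hre.
  apply Rabs_le_between in Hre.
  assert (Hre1 : Re z = 1%R) by (rewrite <- (cos_acos (Re z)), Hac by lra; apply cos_0).
  pose proof (Cmod2_alt z) as H2. rewrite Hm, Hre1 in H2.
  assert (Him : Im z = 0%R) by nra.
  apply injective_projections; [exact Hre1|exact Him].
Qed.

Lemma apostol_radius_pos (lam : C) : Rbar_lt 0 (apostol_radius lam).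
Proof.
  unfold apostol_radius. destruct (Ceq_dec lam 0) as [|H0]; [exact I|].
  destruct (Ceq_dec lam (-1)%R) as [|H1]; simpl.
  - pose proof PI_RGT_0. lra.
  - apply Cmod_gt_0. intros E. apply Clog_eq_0 in E.
    + apply H1. replace lam with (- - lam) by ring. rewrite E.
      apply injective_projections; simpl; ring.
    + intros E0. apply H0. replace lam with (- - lam) by ring. rewrite E0. ring.
Qed.

Lemma apostol_disc_ball (lam : C) :
  exists r : R, (0 < r)%R /\ forall t : C, t <> 0 -> (Cmod t < r)%R -> apostol_disc lam t.
Proof.
  pose proof (apostol_radius_pos lam) as H. unfold apostol_disc.
  destruct (apostol_radius lam) as [r| |]; simpl in H |- *.
  - exists r. now split.
  - exists 1%R. split; [lra|]. auto.
  - contradiction.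
Qed.

Lemma apostol_disc_larger (lam t : C) :
  apostol_disc lam t -> exists t', apostol_disc lam t' /\ (Cmod t < Cmod t')%R.
Proof.
  intros [Ht H]. apply Cmod_gt_0 in Ht.
  assert (exists r : R, (Cmod t < r)%R /\ Rbar_lt r (apostol_radius lam)) as (r & H1 & H2).
  { destruct (apostol_radius lam) as [r| |]; simpl in H.
    - exists ((Cmod t + r) / 2)%R. simpl. lra.
    - exists (Cmod t + 1)%R. simpl. split; [lra|exact I].
    - contradiction. }
  assert (Hr : Cmod (RtoC r) = r) by (rewrite Cmod_R, Rabs_pos_eq; lra).
  exists (RtoC r). unfold apostol_disc. rewrite Hr. repeat split; try assumption.
  apply Cmod_gt_0. lra.
Qed.

Lemma is_egf_restrict (D : C -> Prop) (G : C -> C) (a : nat -> C) :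
  is_egf (fun _ => True) G a -> is_egf D G a.
Proof. intros H t _. exact (H t I). Qed.

Lemma is_egf_ext (D : C -> Prop) (F G : C -> C) (a : nat -> C) :
  (forall t, F t = G t) -> is_egf D F a -> is_egf D G a.
Proof. intros E H t Ht. rewrite <- E. exact (H t Ht). Qed.

(** * The convolution formula *)

Theorem theorem2p1 (alpha : nat) (lam eta delta : C) (n : nat) (hn : (1 <= n)%nat)
    (x1 x2 : C) :
  bell_apostol n alpha x1 x2 lam eta delta =
  sum_n (fun k : nat =>
           (RtoC (Binomial.C n k) * apostol k alpha x1 lam eta delta
            * bell (n - k) x2)%C) n.
Proof.
  unfold bell_apostol, apostol, bell.
  set (D := apostol_disc lam).
  set (F := fun t => apostol_factor alpha lam eta delta t * Cexp (x1 * t)).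
  set (H := fun t => apostol_factor alpha lam eta delta t
                     * Cexp (x1 * t + x2 * (Cexp t - 1))).
  set (B := fun t => Cexp (x2 * (Cexp t - 1))).
  assert (HFB : forall t, F t * B t = H t).
  { intros t. unfold F, B, H. rewrite Cexp_plus. ring. }
  destruct (classic (exists a, is_egf D F a)) as [HF|HF].
  - destruct (apostol_disc_ball lam) as (r & Hr & HD).
    apply (egf_coef_eq D H r
             (binomial_conv (egf_coef D F) (egf_coef (fun _ => True) B)) n Hr HD).
    apply is_egf_ext with (1 := HFB).
    apply is_egf_mult; [exact (apostol_disc_larger lam)|now apply egf_coef_spec|].
    apply is_egf_restrict, egf_coef_spec, ex_egf_bell.
  - rewrite egf_coef_none.
    + transitivity (sum_n (fun _ : nat => RtoC 0) n).
      * clear. induction n as [|n IH]; [now rewrite sum_O|].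
        rewrite sum_Sn, <- IH. symmetry. apply Cplus_0_l.
      * apply sum_n_ext. intros k. rewrite (egf_coef_none D F k HF). Cring.
    + (* Multiplying by the inverse of B, which is the Bell generating
         function at - x2, turns an expansion of H into one of F. *)
      intros [h Hh]. apply HF. destruct (ex_egf_bell (- x2)) as [b Hb].
      exists (binomial_conv h b).
      apply is_egf_ext with (fun t => H t * Cexp (- x2 * (Cexp t - 1))).
      * intros t. unfold H, F. rewrite <- Cmult_assoc, <- Cexp_plus.
        f_equal. f_equal. ring.
      * apply is_egf_mult; [exact (apostol_disc_larger lam)|exact Hh|].
        now apply is_egf_restrict.
Qed.
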